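(* Let $K,N\in\mathbb{N}^{>0}$. There is $L\in\mathbb{N}^{>0}$ such that for any group $G$ and any family $\mathcal{X}$ of uniformly $N$-commensurable $K$-approximate subgroups of $G$, there is an $L$-approximate subgroup $H\subseteq G$ which is $L$-commensurable with $\mathcal{X}$ (that is, with every member of $\mathcal{X}$) and invariant under all automorphisms of $G$ stabilizing $\mathcal{X}$ set-wise (that is, $\sigma(H)=H$ for every automorphism $\sigma$ of $G$ with $\{\sigma(X):X\in\mathcal{X}\}=\mathcal{X}$).
   Context: For $K\in\mathbb{N}^{>0}$ and a group $G$, a subset $A\subseteq G$ is a $K$-approximate subgroup if $1_G\in A$, $A=A^{-1}$, and there is $X\subseteq G$ with $|X|\le K$ and $AA\subseteq XA$. For $N\in\mathbb{N}^{>0}$, approximate subgroups $X,Y$ of $G$ are $N$-commensurable if there are $Z_0,Z_1\subseteq G$ with $\max\{|Z_0|,|Z_1|\}\le N$ such that $X\subseteq Z_0Y$ and $Y\subseteq Z_1X$. A family $\mathcal{X}$ is uniformly $N$-commensurable if any $X,Y\in\mathcal{X}$ are $N$-commensurable. *)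

(* Defs.v *)
From HB Require Import structures.
From mathcomp Require Import all_boot monoid.
From mathcomp Require Import boolp classical_sets functions cardinality.

Set Implicit Arguments.
Unset Strict Implicit.
Unset Printing Implicit Defensive.

Local Open Scope classical_set_scope.
Local Open Scope card_scope.
Local Open Scope group_scope.

Section ApproximateSubgroups.
Context {G : groupType}.
Implicit Types (A X Y Z : set G) (XX : set (set G)) (K N : nat).

Definition set_mul A B : set G := [set a * b | a in A & b in B].

Definition set_inv A : set G := [set a^-1 | a in A].

Definition approx_subgroup K A : Prop :=
  [/\ A 1, A = set_inv A &
      exists X, X #<= `I_K /\ set_mul A A `<=` set_mul X A].

Definition commensurable N X Y : Prop :=
  exists Z0 Z1, [/\ Z0 #<= `I_N, Z1 #<= `I_N,
                    X `<=` set_mul Z0 Y & Y `<=` set_mul Z1 X].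

Definition uniformly_commensurable N XX : Prop :=
  forall X Y, XX X -> XX Y -> commensurable N X Y.

Definition stabilizes (sigma : G -> G) XX : Prop :=
  [set sigma @` X | X in XX] = XX.

End ApproximateSubgroups.

(* Main.v *)
(** For a finite list [l] of members of the family, let [Y_l] be the
    intersection of the sets [X^2] with [X] in [l].  Call [l] [(n, m)]-strong
    if it has length at most [n] and every member of the family covers [Y_l] by
    at most [m] left translates.  Lengthening [l] shrinks [Y_l], and [m] starts
    at [K * N], so for any fixed [c] there are [n], [m], bounded in terms of
    [c], [K], [N], such that [(n, m)]-strong lists exist while [(c n, m - 1)]-strong
    ones do not.  Take for [H] the union of the [Y_l] over all [(n, m)]-strong
    [l]; it is visibly invariant.  If [Y] is the intersection of at most [c]
    such sets, then some [X] does not cover [Y] by [m - 1] translates; so [Y]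
    meets every translate in any cover of a [Y_l] containing [Y] by [m]
    translates of [X], whence [Y_l] is contained in [Y X^2].  Thus any [c]
    points of [H] lie in [Y X^2], which is covered by a number of translates of
    a fixed member that depends only on [K] and [N].  Choosing [c] larger than
    this number, pigeonhole shows that [H] is covered by fewer than [c]
    translates [e X^2] with [e] in [H].  Finally, [e] lies in some [X_1^2], so
    it commensurates [X], which bounds [H H]. *)
Require Import Defs.
From mathcomp Require Import all_boot monoid.
From mathcomp Require Import boolp classical_sets functions cardinality.

Local Open Scope classical_set_scope.

(** * Covers by left translates, colourings and separated lists *)

Section Covering.
Set Implicit Arguments.
Unset Strict Implicit.
Local Open Scope group_scope.
Context {G : groupType}.
Implicit Types (A B C D X Y : set G) (s : seq G) (k : nat).

Local Notation "A ** B" := (set_mul A B) (at level 40, left associativity).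

Lemma set_mulA A B C : A ** (B ** C) = A ** B ** C.
Proof.
apply/seteqP; split=> [_ [a Aa [_ [b Bb [c Cc <-]]] <-]|].
  by exists (a * b); [exists a => //; exists b | exists c => //; rewrite mulgA].
move=> _ [_ [a Aa [b Bb <-]] [c Cc <-]].
by exists a => //; exists (b * c); [exists b => //; exists c | rewrite mulgA].
Qed.

Lemma set_mulSS A B C D : A `<=` B -> C `<=` D -> A ** C `<=` B ** D.
Proof. by move=> AB CD _ [a /AB Ba [c /CD Dc <-]]; exists a => //; exists c. Qed.

Definition covered k A B := exists s, (size s <= k)%N /\ A `<=` [set` s] ** B.

Lemma covered_card k A B :
  covered k A B <-> exists Z : set G, (Z #<= `I_k)%card /\ A `<=` Z ** B.
Proof.
split=> [[s [sk AsB]]|[Z [Zk AZB]]].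
  exists [set` s]; split=> //.
  have sE : [set` s] `<=` nth 1 s @` `I_(size s).
    by move=> x /= xs; exists (index x s); rewrite /= ?index_mem ?nth_index.
  apply: (card_le_trans (subset_card_le sE)).
  by apply: (card_le_trans (card_image_le _ _)); rewrite card_le_II.
have Zfin : finite_set Z by apply/finite_set_leP; exists k.
exists (finmap.enum_fset (fset_set Z)); split; first exact: geq_card_fset_set.
apply: subset_trans AZB _; apply: set_mulSS => // z Zz /=.
by rewrite in_fset_set // inE.
Qed.

Lemma covered_sub k k' A A' B B' :
  (k <= k')%N -> A' `<=` A -> B `<=` B' -> covered k A B -> covered k' A' B'.
Proof.
move=> kk' A'A BB' [s [sk AsB]]; exists s; split; first exact: leq_trans kk'.
by apply: subset_trans A'A _; apply: subset_trans AsB _; apply: set_mulSS.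
Qed.

Lemma covered_trans k k' A B C :
  covered k A B -> covered k' B C -> covered (k * k') A C.
Proof.
move=> [s [sk AsB]] [t [tk BtC]].
exists [seq x * y | x <- s, y <- t]; split; first by rewrite size_allpairs leq_mul.
move=> _ /AsB[x xs [_ /BtC[y yt [c Cc <-]] <-]].
by exists (x * y); [apply: allpairs_f | exists c => //; rewrite mulgA].
Qed.

Lemma covered_mulr k A B C : covered k A B -> covered k (A ** C) (B ** C).
Proof.
move=> [s [sk AsB]]; exists s; split=> //.
by rewrite set_mulA; apply: set_mulSS.
Qed.

Lemma covered_bigcup k k' (s : seq G) (F : G -> set G) B :
  (size s <= k)%N -> (forall e, e \in s -> covered k' (F e) B) ->
  covered (k * k') (\bigcup_(e in [set` s]) F e) B.
Proof.
move=> sk sF.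
have {sF} [t tP] : exists t : G -> seq G, forall e, e \in s ->
    (size (t e) <= k')%N /\ F e `<=` [set` t e] ** B.
  have /choice[t tP] : forall e, exists t, e \in s ->
      (size t <= k')%N /\ F e `<=` [set` t] ** B.
    move=> e; case: (boolP (e \in s)) => [/sF[t]|_]; last by exists [::].
    by exists t.
  by exists t.
exists (flatten (map t s)); split.
  rewrite size_flatten /shape -map_comp sumnE big_map.
  apply: (@leq_trans (\sum_(e <- s) k')).
    by rewrite big_seq [leqRHS]big_seq; apply: leq_sum => e /tP[].
  by rewrite big_const_seq count_predT iter_addn_0 mulnC leq_mul.
move=> x [e /= es]; have [_ te] := tP e es => /te[y yt [b Bb <-]].
by exists y; [apply/flatten_mapP; exists e | exists b].
Qed.

(* A colouring of [A] with [k] colours such that monochromatic pairs are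
   [B]-close.  Unlike covers, colourings can be superposed to pass to
   intersections of several [B]'s. *)
Definition colored k A B := exists f : G -> nat,
  (forall a, A a -> (f a < k)%N) /\
  forall a b, A a -> A b -> f a = f b -> B (a^-1 * b).

(** Colour a point by the first translate [z X] of the cover containing it; two points of [z X]
    differ by an element of [X^-1 X]. *)
Lemma covered_colored k A X : (forall x, X x -> X x^-1) ->
  covered k A X -> colored k A (X ** X).
Proof.
move=> XV [s [sk AsX]]; pose p a z := `[< X (z^-1 * a) >].
have hasA a : A a -> has (p a) s.
  move=> /AsX[z zs [x Xx <-]]; apply/hasP; exists z => //.
  by apply/asboolP; rewrite mulKg.
exists (fun a => find (p a) s); split.
  by move=> a /hasA; rewrite has_find => /leq_trans; apply.
move=> a b Aa Ab fab.
have /asboolP Xa := nth_find 1 (hasA a Aa).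
have /asboolP Xb := nth_find 1 (hasA b Ab).
rewrite -fab in Xb.
exists (((nth 1 s (find (p a) s))^-1 * a)^-1); first exact: XV.
exists ((nth 1 s (find (p a) s))^-1 * b) => //.
by rewrite invgM invgK -mulgA mulVKg.
Qed.

Lemma colored_setI k k' A B C :
  colored k A B -> colored k' A C -> colored (k * k') A (B `&` C).
Proof.
move=> [f [fk fB]] [g [gk gC]].
(* The pair of colours is encoded as a two-digit number whose last digit is in base [k']. *)
exists (fun a => f a * k' + g a)%N; split=> [a Aa|a b Aa Ab fg].
  apply: (@leq_trans ((f a).+1 * k')%N); last by rewrite leq_mul // fk.
  by rewrite mulSn addnC ltn_add2r gk.
have k'0 : (0 < k')%N by apply: leq_ltn_trans (gk a Aa).
have /(congr1 (divn^~ k')) := fg.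
have /(congr1 (modn^~ k')) := fg.
rewrite /= !modnMDl !divnMDl // !modn_small ?divn_small ?gk // !addn0 => gab fab.
by split; [apply: fB | apply: gC].
Qed.

Lemma colored_covered k A B : colored k A B -> covered k A B.
Proof.
move=> [f [fk fB]].
pose r i := xget 1 [set a | A a /\ f a = i].
exists (map r (iota 0 k)); split; first by rewrite size_map size_iota.
move=> a Aa; have [Ar fr] : A (r (f a)) /\ f (r (f a)) = f a.
  by apply: (@xgetPex _ 1 [set b | A b /\ f b = f a]); exists a.
exists (r (f a)); first by apply: map_f; rewrite mem_iota fk.
by exists ((r (f a))^-1 * a); [apply: fB | rewrite mulVKg].
Qed.

(** Greedy choice: while the translates by the points chosen so far miss a point of [A], put that
    point at the head of the list. *)
Lemma cover_or_separated k A B : exists s : seq G,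
  [/\ forall x, x \in s -> A x, pairwise (fun x y => `[< ~ B (y^-1 * x) >]) s &
      size s = k \/ ((size s <= k)%N /\ A `<=` [set` s] ** B)].
Proof.
elim: k => [|k [s [sA sep [sk|[sk cov]]]]]; first by exists [::]; split=> //; left.
- have [cov|] := pselect (A `<=` [set` s] ** B).
    by exists s; split=> //; right; rewrite sk.
  move=> /existsNP[x /not_implyP[Ax xs]].
  exists (x :: s); split=> /=.
  + by move=> y; rewrite inE => /predU1P[->//|/sA].
  + rewrite sep andbT; apply/allP => y ys; apply/asboolP => Byx.
    by apply: xs; exists y => //; exists (y^-1 * x) => //; rewrite mulVKg.
  + by left; rewrite sk.
- by exists s; split=> //; right; split=> //; apply: leq_trans sk _.
Qed.

Lemma separated_size k s A B : colored k A B -> (forall x, x \in s -> A x) ->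
  pairwise (fun x y => `[< ~ B (y^-1 * x) >]) s -> (size s <= k)%N.
Proof.
move=> [f [fk fB]] sA sep; rewrite -(size_map f) -[leqRHS](size_iota 0 k).
apply: uniq_leq_size.
  rewrite uniq_pairwise pairwise_map.
  apply: (sub_in_pairwise _ (allss s) sep) => x y /sA Ax /sA Ay /asboolP nB /=.
  by apply/eqP => fxy; apply: nB; apply: fB.
by move=> _ /mapP[x /sA Ax ->]; rewrite mem_iota fk.
Qed.

(** A translate [z X] disjoint from [B] could be dropped, leaving [k] translates that cover [B]. So
    every [z X] contains some [z y] in [B], and [z x = (z y)(y^-1 x)]. *)
Lemma covered_tight k A B X : (forall x, X x -> X x^-1) -> B `<=` A ->
  covered k.+1 A X -> ~ covered k B X -> A `<=` B ** (X ** X).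
Proof.
move=> XV BA [s [sk AsX]] ncov a /AsX[z zs [x Xx <-]].
have [[y Xy Bzy]|nB] := pselect (exists2 y, X y & B (z * y)).
  exists (z * y) => //; exists (y^-1 * x); last by rewrite -mulgA mulVKg.
  by exists y^-1; [apply: XV | exists x].
case: ncov; exists (rem z s); split; first by rewrite size_rem // -subn1 leq_subLR add1n.
move=> b Bb; have [w ws [y Xy wy]] := AsX b (BA b Bb); exists w; last by exists y.
have : w \in z :: rem z s by rewrite -(perm_mem (perm_to_rem zs)).
rewrite inE => /predU1P[wz|//]; case: nB; exists y => //.
by rewrite -wz wy.
Qed.

End Covering.

(** * Strong lists and the union of their intersections *)

Section Family.
Set Implicit Arguments.
Unset Strict Implicit.
Local Open Scope group_scope.
Context {G : groupType} (K N : nat) (XX : set (set G)).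
Context (XXK : forall X, XX X -> approx_subgroup K X)
        (XXN : uniformly_commensurable N XX).
Implicit Types (X Y : set G) (l : seq (set G)) (n m : nat).

Local Notation "A ** B" := (set_mul A B) (at level 40, left associativity).

Lemma approx1 X : XX X -> X 1.
Proof. by case/XXK. Qed.

Lemma approxV X x : XX X -> X x -> X x^-1.
Proof. by case/XXK => _ XE _ Xx; rewrite XE; exists x. Qed.

Lemma approxM X : XX X -> covered K (X ** X) X.
Proof. by case/XXK => _ _ ?; apply/covered_card. Qed.

Lemma commensurable_covered X Y : XX X -> XX Y -> covered N X Y.
Proof.
move=> XXX XXY; have [Z [Z' [ZN _ XZY _]]] := XXN XXX XXY.
by apply/covered_card; exists Z.
Qed.

Lemma approxM3 X : XX X -> covered (K * K) (X ** (X ** X)) X.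
Proof.
move=> XXX; apply: covered_trans (approxM XXX); rewrite set_mulA.
exact/covered_mulr/approxM.
Qed.

Definition cap_sq l : set G := [set g | forall X, X \in l -> (X ** X) g].

(** The condition [0 < size l] excludes the empty list, whose [cap_sq] is all of [G]; thus each
    point of [strong_union] lies in the square of some member. *)
Definition strong n m l := [/\ (0 < size l <= n)%N, forall X, X \in l -> XX X &
  forall X, XX X -> covered m (cap_sq l) X].

Definition strong_union n m : set G := [set g | exists2 l, strong n m l & cap_sq l g].

Lemma cap_sqS l l' : {subset l <= l'} -> cap_sq l' `<=` cap_sq l.
Proof. by move=> ll' g gl' X /ll'; apply: gl'. Qed.

Lemma cap_sq1 l : (forall X, X \in l -> XX X) -> cap_sq l 1.
Proof.
move=> lXX X /lXX XXX; exists 1; first exact: approx1.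
by exists 1; [exact: approx1 | rewrite mulg1].
Qed.

Lemma cap_sqV l g : (forall X, X \in l -> XX X) -> cap_sq l g -> cap_sq l g^-1.
Proof.
move=> lXX gl X Xl; have XXX := lXX X Xl; have [x Xx [y Xy <-]] := gl X Xl.
by exists y^-1; [exact: approxV | exists x^-1; [exact: approxV | rewrite invgM]].
Qed.

Lemma colored_cap_sq X l : XX X -> (forall Y, Y \in l -> XX Y) ->
  colored (N ^ size l) X (cap_sq l).
Proof.
move=> XXX; elim: l => [|Y l IHl] lXX.
  by exists (fun=> 0%N).
have XXY : XX Y by apply: lXX; rewrite inE eqxx.
have cY : colored N X (Y ** Y).
  by apply: covered_colored (commensurable_covered XXX XXY) => x; apply: approxV.
have cl : colored (N ^ size l) X (cap_sq l).
  by apply: IHl => Z Zl; apply: lXX; rewrite inE Zl orbT.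
have [f [fk fP]] := colored_setI cY cl.
exists f; split; first by rewrite expnS.
move=> a b Aa Ab /(fP a b Aa Ab)[fY fl] Z; rewrite inE => /predU1P[->//|].
exact: fl.
Qed.

Lemma strong1 X : XX X -> strong 1 (K * N) [:: X].
Proof.
move=> XXX; split=> //= [Y|Y XXY]; first by rewrite inE => /eqP ->.
apply: covered_trans (commensurable_covered XXX XXY).
apply: covered_sub (approxM XXX) => // g; apply; exact: mem_head.
Qed.

Context (X0 : set G) (XX0 : XX X0).

Lemma strong_gt0 n m l : strong n m l -> (0 < m)%N.
Proof.
move=> [_ lXX lm]; have [s [sm]] := lm X0 XX0.
move=> /(_ 1 (cap_sq1 lXX))[z zs _]; apply: leq_trans sm.
by case: s zs.
Qed.

(** Descent on [m]: each failure of stability multiplies the length bound by [c] and saves one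
    translate. By [strong_gt0] this stops before [m] reaches 0. *)
Lemma stable_strong c n m : (0 < c)%N ->
  (exists l, strong n m l) -> exists n' m', [/\ (n' <= c ^ m * n)%N, (m' < m)%N,
    exists l, strong n' m'.+1 l & ~ exists l, strong (c * n') m' l].
Proof.
move=> c0; elim: m n => [|m IHm] n; first by move=> [l /strong_gt0].
have [/IHm[n' [m' [n'n m'm ? ?]]] _|ncl nm] := pselect (exists l, strong (c * n) m l).
  by exists n', m'; split=> //; [rewrite expnSr -mulnA | apply: ltnW].
by exists n, m; split=> //; rewrite leq_pmull // expn_gt0 c0.
Qed.

Lemma strong_cat n m (s : seq G) : (forall x, x \in s -> strong_union n m x) ->
  exists l, [/\ (size l <= size s * n)%N, forall X, X \in l -> XX X &
    forall x, x \in s -> exists2 l', strong n m l' & cap_sq l' x /\ {subset l' <= l}].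
Proof.
elim: s => [|x s IHs] sU; first by exists [::].
have [l [ls lXX lP]] : exists l, [/\ (size l <= size s * n)%N, forall X, X \in l -> XX X &
    forall x, x \in s -> exists2 l', strong n m l' & cap_sq l' x /\ {subset l' <= l}].
  by apply: IHs => y ys; apply: sU; rewrite inE ys orbT.
have [l' sl' l'x] := sU x (mem_head _ _); have [/andP[_ l'n] l'XX _] := sl'.
exists (l' ++ l); split.
- by rewrite size_cat mulSn leq_add.
- by move=> X; rewrite mem_cat => /orP[/l'XX|/lXX].
- move=> y; rewrite inE => /predU1P[->|/lP[l'' sl'' [l''y l''l]]].
    by exists l' => //; split=> // X Xl'; rewrite mem_cat Xl'.
  by exists l'' => //; split=> // X /l''l Xl; rewrite mem_cat Xl orbT.
Qed.

(** Witness lists for the points of [s] concatenate to a list [l] of length at most [c * n], which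
    cannot be strong for [m]. The member [X] showing this depends on [s], but the bound does not, as
    the cover is transferred to [X0]. *)
Lemma strong_union_seq c n m (s : seq G) : (0 < size s <= c)%N ->
  (~ exists l, strong (c * n) m l) ->
  (forall x, x \in s -> strong_union n m.+1 x) ->
  covered (m.+1 * (K * K * N)) [set` s] X0.
Proof.
move=> /andP[s0 sc] nst /strong_cat[l [ln lXX lP]].
have [x xs] : exists x, x \in s by case: (s) s0 => // x ? _; exists x; apply: mem_head.
have [l' [/andP[l'0 _] _ l'm] [_ l'l]] := lP x xs.
have l0 : (0 < size l)%N.
  by case: (l') l'0 l'l => // X ? _ /(_ X (mem_head _ _)); case: (l).
have [X [XXX nX]] : exists X, XX X /\ ~ covered m (cap_sq l) X.
  apply: contrapT => /forallNP nX; apply: nst; exists l; split=> //.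
    apply/andP; split=> //; apply: leq_trans ln _.
    by rewrite leq_mul2r sc orbT.
  by move=> X XXX; apply: contrapT => ncov; apply: (nX X).
have XV x := approxV (x := x) XXX.
(* [X] covers [cap_sq l''] by [m.+1] translates but not the smaller [cap_sq l] by [m], so
   [covered_tight] applies. *)
have sY y : y \in s -> (cap_sq l ** (X ** X)) y.
  move=> /lP[l'' [_ _ l''m] [l''y /cap_sqS l''l]].
  exact: (covered_tight XV l''l (l''m X XXX) nX).
have lX : covered m.+1 (cap_sq l) X.
  by apply: covered_sub (l'm X XXX) => //; apply: cap_sqS.
apply: covered_sub (leqnn _) sY (@subset_refl _ _) _.
apply: covered_trans (covered_mulr _ lX) _.
exact: covered_trans (approxM3 XXX) (commensurable_covered XXX XX0).
Qed.

Lemma covered_sq_mul_sq X e : XX X -> (X ** X) e ->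
  covered (K * N * (K * K) * N) (X0 ** X0 ** [set e]) X0.
Proof.
move=> XXX Xe; apply: covered_trans (commensurable_covered XXX XX0).
apply: covered_trans (approxM3 XXX).
have sub : X0 ** X0 ** [set e] `<=` X0 ** X0 ** (X ** X).
  by apply: set_mulSS => // _ ->.
apply: covered_sub (leqnn _) sub (@subset_refl _ _) _.
apply/covered_mulr/(covered_trans (approxM XX0)).
exact: commensurable_covered.
Qed.

(** Otherwise there is a separated list of [c] points; its cover by fewer than [c] translates of
    [X0] colours it with fewer than [c] colours, contradicting separation. *)
Lemma strong_union_cover c n m : (m.+1 * (K * K * N) < c)%N ->
  (~ exists l, strong (c * n) m l) -> exists s : seq G,
  [/\ (size s <= c)%N, forall e, e \in s -> strong_union n m.+1 e &
      strong_union n m.+1 `<=` [set` s] ** (X0 ** X0)].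
Proof.
move=> mc nst.
have [s [sU sep [sc|[sc cov]]]] :=
  cover_or_separated c (strong_union n m.+1) (X0 ** X0); last by exists s.
have scov : covered (m.+1 * (K * K * N)) [set` s] X0.
  by apply: (@strong_union_seq c n) => //; rewrite sc leqnn andbT; apply: leq_trans mc.
have scol := covered_colored (fun x => approxV (x := x) XX0) scov.
have := separated_size scol (fun x xs => xs) sep.
by rewrite sc leqNgt mc.
Qed.

Lemma covered_strong_union n m l X : (0 < N)%N -> XX X ->
  strong n m l -> covered (N ^ n) X (strong_union n m).
Proof.
move=> N0 XXX sl; have [/andP[_ ln] lXX _] := sl.
apply: covered_sub (colored_covered (colored_cap_sq XXX lXX)) => //.
  by rewrite leq_pexp2l.
by move=> g gl; exists l.
Qed.

Lemma strong_unionM c n m : (0 < N)%N -> (m.+1 * (K * K * N) < c)%N ->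
  (exists l, strong n m.+1 l) -> (~ exists l, strong (c * n) m l) ->
  covered (c * (c * (K * N * (K * K) * N * (K * K)) * N ^ n))
    (strong_union n m.+1 ** strong_union n m.+1) (strong_union n m.+1).
Proof.
move=> N0 mc [l sl] nst; have [s [sc sU cov]] := strong_union_cover mc nst.
have Ucov : covered c (strong_union n m.+1) (X0 ** X0) by exists s.
apply: covered_trans (covered_mulr _ Ucov) _.
apply: covered_trans (covered_strong_union N0 XX0 sl).
(* Covering the right factor as well leaves sets [X0^2 e X0^2]; [covered_sq_mul_sq] absorbs [e] into
   the left half. *)
have sub : X0 ** X0 ** strong_union n m.+1 `<=`
    \bigcup_(e in [set` s]) (X0 ** X0 ** [set e] ** (X0 ** X0)).
  move=> _ [y X0y [_ /cov[e es [z X0z <-]] <-]]; exists e => //.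
  by exists (y * e); [exists y => //; exists e | exists z => //; rewrite mulgA].
apply: covered_sub (leqnn _) sub (@subset_refl _ _) _.
apply: covered_bigcup sc _ => e /sU[l' [/andP[l'0 _] l'XX _] l'e].
apply: covered_trans (approxM3 XX0); apply: covered_mulr.
have [X Xl'] : exists X, X \in l'.
  by case: (l') l'0 => // X l'' _; exists X; apply: mem_head.
exact: (covered_sq_mul_sq (l'XX X Xl') (l'e X Xl')).
Qed.

Lemma strong_union_morph n m (f g : G -> G) :
  {morph f : x y / x * y} -> cancel f g -> cancel g f ->
  (forall X, XX X -> XX (f @` X)) -> (forall X, XX X -> XX (g @` X)) ->
  f @` strong_union n m `<=` strong_union n m.
Proof.
move=> fM fK gK fXX gXX _ [x [l [ln lXX lm] lx] <-].
have gM : {morph g : x y / x * y} by move=> a b; apply: (can_inj fK); rewrite fM !gK.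
exists (map (fun X => f @` X) l); last first.
  move=> _ /mapP[X /lx[a Xa [b Xb <-]] ->].
  by exists (f a); [exists a | exists (f b); [exists b | rewrite fM]].
split; first by rewrite size_map.
  by move=> _ /mapP[X /lXX XXX ->]; apply: fXX.
(* Pull [X] back along [g], cover [cap_sq l] there, and push the translates forward by [f]. *)
move=> X /gXX/lm[s [sm ls]]; exists (map f s); split; first by rewrite size_map.
move=> y yl.
have /ls[z zs [_ [w Xw <-] zw]] : cap_sq l (g y).
  move=> Y Yl; have [_ [a Ya <-] [_ [b Yb <-] aby]] := yl _ (map_f _ Yl).
  by exists a => //; exists b => //; rewrite -aby gM !fK.
exists (f z); first exact: map_f.
by exists w => //; rewrite -[w]gK -fM zw gK.
Qed.

Lemma approx_subgroup_strong_union L n m : (exists l, strong n m l) ->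
  covered L (strong_union n m ** strong_union n m) (strong_union n m) ->
  approx_subgroup L (strong_union n m).
Proof.
move=> [l sl] /covered_card UU; split=> //.
  by exists l => //; apply: cap_sq1; case: sl.
have UV x : strong_union n m x -> strong_union n m x^-1.
  by move=> [l' sl' l'x]; exists l' => //; apply: cap_sqV => //; case: sl'.
apply/seteqP; split=> [x /UV Ux|_ [x /UV Ux <-] //].
by exists x^-1 => //; rewrite invgK.
Qed.

End Family.

(** * Uniform constants and conclusion *)

Lemma commensurable_coveredP {G : groupType} k (X Y : set G) :
  commensurable k X Y <-> covered k X Y /\ covered k Y X.
Proof.
split=> [[Z [Z' [? ? ? ?]]]|[/covered_card[Z [? ?]] /covered_card[Z' [? ?]]]].
  by split; apply/covered_card; [exists Z | exists Z'].
by exists Z, Z'.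
Qed.

Theorem corollary1p4 (K N : nat) (K_gt0 : (0 < K)%N) (N_gt0 : (0 < N)%N) :
  exists L : nat, (0 < L)%N /\
    forall (G : groupType) (XX : set (set G)),
      (forall X : set G, XX X -> approx_subgroup K X) ->
      uniformly_commensurable N XX ->
      exists H : set G,
        [/\ approx_subgroup L H,
            forall X : set G, XX X -> commensurable L H X &
            forall sigma : {multiplicative G -> G},
              bijective sigma -> stabilizes sigma XX -> sigma @` H = H].
Proof.
(* The descent starts at length 1 and [K * N] translates, so [m.+1 <= K * N] and [n <= c ^ (K * N)]
   at its end; hence [c] exceeds the bound of [strong_union_seq] and [b] bounds [N ^ n]. [L] sums
   the three bounds needed. *)
pose c := (K * N * (K * K * N)).+1.
pose b := (N ^ (c ^ (K * N)))%N.
pose q := (c * (K * N * (K * K) * N * (K * K)))%N.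
pose L := (c * (q * b) + c * K + b)%N.
have b_gt0 : (0 < b)%N by rewrite expn_gt0 N_gt0.
exists L; split; first by rewrite addn_gt0 b_gt0 orbT.
move=> G XX XXK XXN.
(* For the empty family the trivial subgroup serves. *)
have [[X0 XX0]|noX] := pselect (XX !=set0); last first.
  exists [set 1%g]; split.
  - split=> //.
      by apply/seteqP; split=> [_ ->|_ [_ -> <-]];
        rewrite /= ?invg1 //; exists 1%g; rewrite ?invg1.
    apply/covered_card; exists [:: 1%g]; split; first by rewrite addn_gt0 b_gt0 orbT.
    by apply: set_mulSS => // _ ->; rewrite /= inE.
  - by move=> X XXX; case: noX; exists X.
  - move=> sigma sigma_bij _.
    by rewrite image_set1 -(mulgK (sigma 1%g) (sigma 1%g)) -gmulfM mul1g mulgV.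
have start : exists l, strong XX 1 (K * N) l.
  by exists [:: X0]; apply: (strong1 XXK XXN).
have [n [m [nc mKN strongl nstrong]]] := stable_strong XXK XX0 (isT : 0 < c)%N start.
have mc : (m.+1 * (K * K * N) < c)%N by rewrite ltnS leq_mul.
have nb : (N ^ n <= b)%N by rewrite leq_pexp2l // -[leqRHS]muln1.
have cov X : XX X -> covered (N ^ n) X (strong_union XX n m.+1).
  move=> XXX; have [l sl] := strongl.
  exact: (covered_strong_union XXK XXN N_gt0 XXX sl).
exists (strong_union XX n m.+1); split.
- apply: (approx_subgroup_strong_union XXK strongl).
  apply: covered_sub (strong_unionM XXK XXN XX0 N_gt0 mc strongl nstrong) => //.
  rewrite /L -addnA; apply: leq_trans (leq_addr _ _).
  by rewrite leq_mul2l leq_mul2l nb !orbT.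
- move=> X XXX; apply/commensurable_coveredP; split; last first.
    by apply: covered_sub (cov X XXX) => //; apply: leq_trans nb (leq_addl _ _).
  (* Taking [X] itself as the base member avoids a further factor [N]. *)
  have [s [sc _ Us]] := strong_union_cover XXK XXN XXX mc nstrong.
  have UX : covered c (strong_union XX n m.+1) (set_mul X X) by exists s.
  apply: covered_sub (covered_trans UX (approxM XXK XXX)) => //.
  by rewrite /L addnAC leq_addl.
- move=> sigma [tau sK tK] sXX.
  have sX X : XX X -> XX (sigma @` X) by move=> XXX; rewrite -sXX; exists X.
  have tX X : XX X -> XX (tau @` X).
    rewrite -{1}sXX => -[Y XXY <-]; rewrite image_comp.
    rewrite (_ : _ @` Y = Y) //; apply/seteqP; split=> [_ [y Yy <-]|y Yy].
      by rewrite /= sK.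
    by exists y => //=; rewrite sK.
  have sM : {morph sigma : x y / (x * y)%g} by exact: gmulfM.
  have tM : {morph tau : x y / (x * y)%g} by exact: can2_gmulfM.
  apply/seteqP; split; first exact: strong_union_morph sK tK sX tX.
  move=> x Ux; exists (tau x); last exact: tK.
  by apply: (strong_union_morph tM tK sK tX sX); exists x.
Qed.
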